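(* In the integer setting, there is a procedure which, given a covering schedule $\mathcal I=((\beta_0,\sigma_0,w_0),\dots,(\beta_t,\sigma_t,w_t))$ and $\varepsilon,\gamma\in(0,1)$, has cost $O\bigl(\frac{nW}{\varepsilon^2}\log\frac1\gamma\bigr)$ where $W=\mathrm{InvWeight}(\mathcal I)$, and outputs values $\hat Q(\beta_0),\dots,\hat Q(\beta_t)$ such that, if $\mathcal I$ is proper, then with probability at least $1-\gamma$ we have $|\log\hat Q(\beta_i)-\log Q(\beta_i)|\le\varepsilon$ for all $i$.
   Context: Setup. Let $n\ge2$ be an integer, $\mathcal H=\{0,\dots,n\}$. An instance consists of nonnegative counts $c_x$, $x\in\mathcal H$, not all zero, and reals $\beta_{\min}<\beta_{\max}$. Let $Z(\beta)=\sum_xc_xe^{\beta x}$, $\mu_\beta(x)=c_xe^{\beta x}/Z(\beta)$, $Q(\beta)=Z(\beta)/Z(\beta_{\min})$. The procedure accesses the instance only through an oracle which, on query $\beta\in[\beta_{\min},\beta_{\max}]$, returns an independent sample from $\mu_\beta$; cost is the expected number of oracle calls. A segment is a tuple $(\beta,[\sigma^-,\sigma^+],w)$ with $\beta\in[\beta_{\min},\beta_{\max}]$, $\sigma^-\in\mathcal H\cup\{-\infty\}$, $\sigma^+\in\mathcal H\cup\{+\infty\}$, $\sigma^-\le\sigma^+$, $w\in(0,1]$; it is proper if $\mu_\beta(k)\ge w$ for every $k\in\{\sigma^-,\sigma^+\}\cap\mathcal H$. A sequence of segments is proper if all segments are proper; $\mathrm{InvWeight}(\mathcal I)=\sum_{(\beta,\sigma,w)\in\mathcal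 I}1/w$. A covering schedule is a sequence of distinct segments $((\beta_i,[\sigma_i^-,\sigma_i^+],w_i))_{i=0}^t$ with $\beta_{\min}=\beta_0<\dots<\beta_t=\beta_{\max}$ and $-\infty=\sigma_0^-<\sigma_0^+=\sigma_1^-<\sigma_1^+=\dots<\sigma_{t-1}^+=\sigma_t^-<\sigma_t^+=+\infty$. *)

(* Defs.v *)
From mathcomp Require Import all_boot all_order all_algebra.
From mathcomp Require Import all_classical all_reals all_analysis.

Set Implicit Arguments.
Unset Strict Implicit.
Unset Printing Implicit Defensive.

Import Order.TTheory GRing.Theory Num.Theory.
Local Open Scope classical_set_scope.
Local Open Scope ring_scope.

Section Gibbs.
Context {R : realType} {n : nat}.
Implicit Types (c : 'I_n.+1 -> R) (b : R) (x : 'I_n.+1).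

Definition Zpart c b : R := \sum_x c x * expR (b * x%:R).

Definition gibbs c b x : R := c x * expR (b * x%:R) / Zpart c b.

Definition Qratio c (bmin b : R) : R := Zpart c b / Zpart c bmin.

End Gibbs.

Section Schedules.
Context {R : realType}.

(* The endpoints [sigma^-, sigma^+] live in {0, ..., n} together with -oo
   (for sigma^-) or +oo (for sigma^+); they are represented in [\bar int] so
   that they are compared by the usual order. *)
Record segment (n : nat) (bmin bmax : R) := Segment {
  seg_beta : R;
  seg_lo : \bar int;
  seg_hi : \bar int;
  seg_w : R;
  seg_betaP : bmin <= seg_beta <= bmax;
  seg_loP : seg_lo = (-oo)%E \/ exists k : 'I_n.+1, seg_lo = (k%:Z)%:E;
  seg_hiP : seg_hi = (+oo)%E \/ exists k : 'I_n.+1, seg_hi = (k%:Z)%:E;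
  seg_lo_le_hi : (seg_lo <= seg_hi)%E;
  seg_wP : 0 < seg_w <= 1
}.

Definition proper_segment n bmin bmax (c : 'I_n.+1 -> R)
    (s : segment n bmin bmax) : Prop :=
  forall k : 'I_n.+1, seg_lo s = (k%:Z)%:E \/ seg_hi s = (k%:Z)%:E ->
    seg_w s <= gibbs c (seg_beta s) k.

Record covering_schedule (n : nat) (bmin bmax : R) := CoveringSchedule {
  cs_t : nat;
  cs_seg :> 'I_cs_t.+1 -> segment n bmin bmax;
  cs_distinct : injective cs_seg;
  cs_beta_first : seg_beta (cs_seg ord0) = bmin;
  cs_beta_last : seg_beta (cs_seg ord_max) = bmax;
  cs_beta_lt : forall i j : 'I_cs_t.+1, j = i.+1 :> nat ->
    seg_beta (cs_seg i) < seg_beta (cs_seg j);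
  cs_lo_first : seg_lo (cs_seg ord0) = (-oo)%E;
  cs_hi_last : seg_hi (cs_seg ord_max) = (+oo)%E;
  cs_lo_lt_hi : forall i, (seg_lo (cs_seg i) < seg_hi (cs_seg i))%E;
  cs_hi_lo : forall i j : 'I_cs_t.+1, j = i.+1 :> nat ->
    seg_hi (cs_seg i) = seg_lo (cs_seg j)
}.

Definition proper_schedule n bmin bmax (c : 'I_n.+1 -> R)
    (I : covering_schedule n bmin bmax) : Prop :=
  forall i, proper_segment c (I i).

Definition InvWeight n bmin bmax (I : covering_schedule n bmin bmax) : R :=
  \sum_i (seg_w (I i))^-1.

End Schedules.

Section Procedures.
Context {R : realType}.

(* A randomized adaptive procedure with access to a sampling oracle, returning
   a value of type [A]: it stops, or queries the oracle at some
   b in [bmin, bmax] and continues according to the sample received, or flips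
   a private coin of bias p.  The counts are not an argument: they enter only
   through the law of the oracle answers below.  The type is coinductive, so
   that the number of oracle calls need not be bounded. *)
CoInductive procedure (n : nat) (bmin bmax : R) (A : Type) : Type :=
| Return of A
| Query (b : R) of bmin <= b <= bmax & ('I_n.+1 -> procedure n bmin bmax A)
| Coin (p : R) of 0 <= p <= 1 & (bool -> procedure n bmin bmax A).

Section Run.
Context {n : nat} {bmin bmax : R} {A : Type} (c : 'I_n.+1 -> R).
Implicit Type P : procedure n bmin bmax A.

(* Probability that P stops within fewer than k steps with a value in E, each
   query at b being answered by a fresh sample of [gibbs c b]. *)
Fixpoint prob_upto (E : set A) (k : nat) P : R :=
  if k isn't k'.+1 then 0 else
  match P with
  | Return a => \1_E a
  | Query b _ f => \sum_x gibbs c b x * prob_upto E k' (f x)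
  | Coin p _ f =>
      p * prob_upto E k' (f true) + (1 - p) * prob_upto E k' (f false)
  end.

(* Expected number of oracle calls among the first k steps of P. *)
Fixpoint calls_upto (k : nat) P : R :=
  if k isn't k'.+1 then 0 else
  match P with
  | Return _ => 0
  | Query b _ f => 1 + \sum_x gibbs c b x * calls_upto k' (f x)
  | Coin p _ f =>
      p * calls_upto k' (f true) + (1 - p) * calls_upto k' (f false)
  end.

(* Both quantities are nondecreasing in k; their suprema are the probability
   that P stops with a value in E and (by monotone convergence) the expected
   total number of oracle calls. *)
Definition prob_output (E : set A) P : \bar R :=
  ereal_sup (range (fun k => (prob_upto E k P)%:E)).

Definition cost P : \bar R :=
  ereal_sup (range (fun k => (calls_upto k P)%:E)).

End Run.
End Procedures.

(* Positivity is required since [ln] is totalized by 0 outside of ]0, +oo[. *)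
Definition accurate (R : realType) (n : nat) (bmin bmax : R) (c : 'I_n.+1 -> R)
    (I : covering_schedule n bmin bmax) (eps : R) : set ('I_(cs_t I).+1 -> R) :=
  [set Qhat | forall i, 0 < Qhat i /\
     `|ln (Qhat i) - ln (Qratio c bmin (seg_beta (I i)))| <= eps].
Arguments accurate {R n bmin bmax} c I eps _.

(* Main.v *)
Require Import Defs.
From mathcomp Require Import all_boot all_order all_algebra.
From mathcomp Require Import all_classical all_reals all_analysis.
From mathcomp Require Import zify ring lra.

Set Implicit Arguments.
Unset Strict Implicit.
Unset Printing Implicit Defensive.

(* If [k_j] is the common endpoint of the segments [j] and [j+1], then
   [Q (beta_(j+1)) / Q (beta_j)
      = exp ((beta_(j+1) - beta_j) k_j) mu_(beta_j) (k_j) / mu_(beta_(j+1)) (k_j)].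
   Replacing each of these probabilities [p >= w] by an empirical frequency over
   about [r / w] samples, the numerators and the denominators form two products
   of independent factors with relative variance at most [1 / r].  There are at
   most [n + 1] endpoints, so [r] of order [n / eps^2] and Doob's maximal
   inequality make all prefix products accurate at once, with constant
   probability and no union bound over [i].  Independent repetitions bring the
   failure probability down to [gamma]: any output that is close, in all
   coordinates, to the majority of the outputs is accurate. *)

Import Order.TTheory GRing.Theory Num.Theory.
Local Open Scope classical_set_scope.
Local Open Scope ring_scope.

Lemma In_map_iota (T : Type) (Q : T -> Prop) (f : nat -> T) (m : nat) :
  (forall j, (j < m)%N -> Q (f j)) ->
  forall y, List.In y [seq f j | j <- iota 0 m] -> Q y.
Proof.
move=> h; have : forall j, j \in iota 0 m -> Q (f j).
  by move=> j; rewrite mem_iota => /h.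
elim: (iota 0 m) => [|j s IH] //= hs y [<-|]; first by apply: hs; rewrite mem_head.
by apply: IH => i si; apply: hs; rewrite inE si orbT.
Qed.

(** * Finite sampling trees and their expectations *)

Section Samplers.
Context {R : realType} {n : nat} {bmin bmax : R}.

(** A well-founded counterpart of [procedure], so that expectations can be defined and computed by
    structural recursion. *)
Inductive sampler (A : Type) : Type :=
| Done of A
| Ask (b : R) of bmin <= b <= bmax & ('I_n.+1 -> sampler A).

Fixpoint run A (t : sampler A) : procedure n bmin bmax A :=
  match t with
  | Done a => Return n bmin bmax a
  | Ask _ hb f => Query hb (fun x => run (f x))
  end.

Fixpoint sbind A B (t : sampler A) (f : A -> sampler B) : sampler B :=
  match t with
  | Done a => f a
  | Ask _ hb g => Ask hb (fun x => sbind (g x) f)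
  end.

Fixpoint srepeat A (m : nat) (t : sampler A) : sampler (seq A) :=
  if m is m'.+1 then
    sbind t (fun a => sbind (srepeat m' t) (fun s => Done (a :: s)))
  else Done [::].

(** Every branch makes the same number of queries, so that a single step bound exhausts the whole
    tree. *)
Fixpoint ncalls A (t : sampler A) (q : nat) : Prop :=
  match t, q with
  | Done _, 0%N => True
  | Ask _ _ f, q'.+1 => forall x, ncalls (f x) q'
  | _, _ => False
  end.

Lemma ncalls_bind A B (t : sampler A) (f : A -> sampler B) q q' :
  ncalls t q -> (forall a, ncalls (f a) q') -> ncalls (sbind t f) (q + q').
Proof.
move=> + hf; elim: t q => [a|b hb g IH] [|q] //= hq x.
by apply: IH.
Qed.

Lemma ncalls_repeat A m (t : sampler A) q :
  ncalls t q -> ncalls (srepeat m t) (m * q).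
Proof.
move=> ht; elim: m => [|m IH] //=; rewrite mulSn.
apply: ncalls_bind => // a; rewrite -[(m * q)%N]addn0.
exact: ncalls_bind.
Qed.

Context (c : 'I_n.+1 -> R).

Fixpoint Ex A (t : sampler A) (f : A -> R) : R :=
  match t with
  | Done a => f a
  | Ask b _ g => \sum_x gibbs c b x * Ex (g x) f
  end.

Lemma eq_Ex A (t : sampler A) f g : f =1 g -> Ex t f = Ex t g.
Proof. by move=> /funext ->. Qed.

Lemma Ex_bind A B (t : sampler A) (k : A -> sampler B) f :
  Ex (sbind t k) f = Ex t (fun a => Ex (k a) f).
Proof. by elim: t => //= b hb g IH; apply: eq_bigr => x _; rewrite IH. Qed.

Lemma ExD A (t : sampler A) f g :
  Ex t (fun a => f a + g a) = Ex t f + Ex t g.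
Proof.
elim: t => //= b hb h IH; rewrite -big_split /=.
by apply: eq_bigr => x _; rewrite IH mulrDr.
Qed.

Lemma ExZ A (t : sampler A) (u : R) f : Ex t (fun a => u * f a) = u * Ex t f.
Proof.
elim: t => //= b hb h IH; rewrite big_distrr /=.
by apply: eq_bigr => x _; rewrite IH mulrCA.
Qed.

Lemma Ex_repeat_prod A m (t : sampler A) (h : A -> R) :
  Ex (srepeat m t) (fun s => \prod_(a <- s) h a) = Ex t h ^+ m.
Proof.
elim: m => [|m IH] /=; first by rewrite big_nil.
rewrite Ex_bind exprS mulrC -ExZ; apply: eq_Ex => a.
rewrite Ex_bind /= -IH mulrC -ExZ.
by apply: eq_Ex => s; rewrite big_cons.
Qed.

Hypothesis c_ge0 : forall x, 0 <= c x.
Hypothesis c_neq0 : exists x, c x != 0.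

Lemma Zpart_gt0 b : 0 < Zpart c b.
Proof.
have h x : true -> 0 <= c x * expR (b * x%:R).
  by move=> _; rewrite mulr_ge0 ?expR_ge0.
rewrite lt0r /Zpart sumr_ge0 // psumr_neq0 // andbT.
have [x hx] := c_neq0; apply/hasP; exists x; first by rewrite mem_index_enum.
by rewrite /= mulr_gt0 ?expR_gt0 // lt0r hx c_ge0.
Qed.

Lemma gibbs_ge0 b x : 0 <= gibbs c b x.
Proof. by rewrite divr_ge0 ?mulr_ge0 ?expR_ge0 // ltW // Zpart_gt0. Qed.

Lemma sum_gibbs b : \sum_x gibbs c b x = 1.
Proof. by rewrite -big_distrl /= divff // gt_eqF // Zpart_gt0. Qed.

Lemma sum_gibbs_mul b (u : R) : \sum_x gibbs c b x * u = u.
Proof. by rewrite -big_distrl /= sum_gibbs mul1r. Qed.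

Lemma Ex_cst A (t : sampler A) (u : R) : Ex t (fun=> u) = u.
Proof.
elim: t => //= b hb g IH; rewrite -[RHS](sum_gibbs_mul b).
by apply: eq_bigr => x _; rewrite IH.
Qed.

Lemma ler_Ex A (t : sampler A) (f g : A -> R) :
  (forall a, f a <= g a) -> Ex t f <= Ex t g.
Proof.
move=> fg; elim: t => //= b hb h IH; apply: ler_sum => x _.
by rewrite ler_wpM2l ?gibbs_ge0.
Qed.

Lemma Ex_ge0 A (t : sampler A) (f : A -> R) : (forall a, 0 <= f a) -> 0 <= Ex t f.
Proof. by move=> f0; rewrite -(Ex_cst t 0); apply: ler_Ex. Qed.

Lemma prob_upto_le1 A (E : set A) k (P : procedure n bmin bmax A) :
  prob_upto c E k P <= 1.
Proof.
elim: k P => [|k IH] P; first exact: ler01.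
case: P => [a|b hb f|p hp f] /=.
- by rewrite indicE lern1 leq_b1.
- rewrite -[leRHS](sum_gibbs_mul b); apply: ler_sum => x _.
  by rewrite ler_wpM2l ?gibbs_ge0.
- case/andP: hp => p0 p1; rewrite -[leRHS](subrK p) addrC.
  by rewrite lerD // ler_piMr // subr_ge0.
Qed.

Lemma prob_upto_run A (E : set A) (t : sampler A) q :
  ncalls t q -> prob_upto c E q.+1 (run t) = Ex t \1_E.
Proof.
elim: t q => [a|b hb f IH] [|q] //= hq.
by apply: eq_bigr => x _; rewrite -(IH _ q).
Qed.

Lemma calls_upto_run A (t : sampler A) q k :
  ncalls t q -> calls_upto c k (run t) <= q%:R.
Proof.
elim: t q k => [a|b hb f IH] [|q] [|k] //= hq.
rewrite -nat1r lerD2l // -[leRHS](sum_gibbs_mul b).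
by apply: ler_sum => x _; rewrite ler_wpM2l ?gibbs_ge0 ?IH.
Qed.

(** * Moments of empirical counts *)

Section Tally.
Context (b : R) (hb : bmin <= b <= bmax) (k : 'I_n.+1).

Fixpoint tally (N s : nat) : sampler nat :=
  if N is N'.+1 then Ask hb (fun x => tally N' (s + (x == k))) else Done s.

Lemma ncalls_tally N s : ncalls (tally N s) N.
Proof. by elim: N s => [|N IH] s //= x. Qed.

Let p := gibbs c b k.

Lemma sum_gibbs_ind (u v : R) :
  \sum_x gibbs c b x * (u + v * (x == k)%:R) = u + v * p.
Proof.
under eq_bigr do rewrite mulrDr.
rewrite big_split /= sum_gibbs_mul (bigD1 k) //= eqxx mulr1 big1 => [|x /negPf ->].
  by rewrite addr0 mulrC.
by rewrite !mulr0.
Qed.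

Lemma Ex_tally N s : Ex (tally N s) (fun z => z%:R) = s%:R + N%:R * p.
Proof.
elim: N s => [|N IH] s /=; first by rewrite mul0r addr0.
transitivity (\sum_x gibbs c b x * (s%:R + N%:R * p + 1 * (x == k)%:R)).
  by apply: eq_bigr => x _; rewrite IH natrD; ring.
by rewrite sum_gibbs_ind -natr1; ring.
Qed.

(** Squared mean plus the variance of a binomial law, by induction on the number of samples. *)
Lemma Ex_tally_sqr N s :
  Ex (tally N s) (fun z => z%:R ^+ 2) = (s%:R + N%:R * p) ^+ 2 + N%:R * p * (1 - p).
Proof.
elim: N s => [|N IH] s /=; first by rewrite !mul0r !addr0.
transitivity (\sum_x gibbs c b x *
  ((s%:R + N%:R * p) ^+ 2 + N%:R * p * (1 - p)
    + (1 + 2 * (s%:R + N%:R * p)) * (x == k)%:R)).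
  by apply: eq_bigr => x _; rewrite IH natrD; case: (x == k) => /=; ring.
by rewrite sum_gibbs_ind -natr1; ring.
Qed.

End Tally.

(** * Products of empirical frequencies and amplification by repetition *)

Record block := Block {
  blk_beta : R;
  blk_betaP : bmin <= blk_beta <= bmax;
  blk_key : 'I_n.+1;
  blk_size : nat }.

Definition blk_prob (B : block) : R := gibbs c (blk_beta B) (blk_key B).

(** All prefix products are returned, beginning with [a] itself; [truth] has the same layout with
    exact probabilities. *)
Fixpoint chain (a : R) (s : seq block) : sampler (seq R) :=
  if s is B :: s' then
    sbind (tally (blk_betaP B) (blk_key B) (blk_size B) 0) (fun z =>
    sbind (chain (a * (z%:R / (blk_size B)%:R)) s') (fun v => Done (a :: v)))
  else Done [:: a].

Fixpoint truth (a : R) (s : seq block) : seq R :=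
  a :: if s is B :: s' then truth (a * blk_prob B) s' else [::].

Lemma nth_truth (a : R) (s : seq block) i :
  (i <= size s)%N ->
  (truth a s)`_i = a * \prod_(B <- take i s) blk_prob B.
Proof.
elim: s a i => [|B s IH] a [|i] //= hi; rewrite ?big_nil ?mulr1 //.
by rewrite IH // big_cons mulrA.
Qed.

Lemma size_truth (a : R) (s : seq block) :
  size (truth a s) = (size s).+1.
Proof. by elim: s a => [|B s IH] a //=; rewrite IH. Qed.

Lemma ncalls_chain a s : ncalls (chain a s) (\sum_(B <- s) blk_size B).
Proof.
elim: s a => [|B s IH] a /=; first by rewrite big_nil.
rewrite big_cons; apply: ncalls_bind => [|z]; first exact: ncalls_tally.
by rewrite -[X in ncalls _ X]addn0; apply: ncalls_bind.
Qed.

Definition rel_close (d x y : R) : bool := `|x / y - 1| <= d.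

Lemma all2_nth (d : R) (u v : seq R) i : all2 (rel_close d) u v -> (i < size v)%N ->
  `|u`_i / v`_i - 1| <= d.
Proof.
by elim: u v i => [|x u IH] [|y v] [|i] //= /andP[] // _; apply: IH.
Qed.

(** The numerator dominates [(x - 1) ^+ 2]. Hence the bound of [chain_close] is trivial as soon as
    the current ratio leaves the allowed window. *)
Lemma chebyshev_pot (d x M : R) : 0 < d -> 1 <= M -> d < `|x - 1| ->
  1 - (x ^+ 2 * M - 2 * x + 1) / d ^+ 2 <= 0.
Proof.
move=> d0 M1 dx; rewrite subr_le0 ler_pdivlMr ?exprn_gt0 // mul1r.
have : d ^+ 2 <= (x - 1) ^+ 2.
  by rewrite -[leRHS]real_normK ?num_real // ler_sqr ?nnegrE // ltW.
have : 0 <= x ^+ 2 * (M - 1) by rewrite mulr_ge0 ?sqr_ge0 // subr_ge0.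
by lra.
Qed.

(* Doob's maximal inequality for the product martingale [a / P], whose
   successive factors have mean 1 and second moment at most [1 + 1 / r]: the
   subtracted term bounds the mean of [(a / P - 1)^2] at the end of the chain,
   divided by [d^2]. *)
Lemma chain_close (d r a P : R) (s : seq block) :
  0 < d -> 0 < r -> P != 0 ->
  (forall B, List.In B s -> 0 < blk_prob B /\ r <= (blk_size B)%:R * blk_prob B) ->
  1 - ((a / P) ^+ 2 * (1 + r^-1) ^+ size s - 2 * (a / P) + 1) / d ^+ 2
    <= Ex (chain a s) (fun v => (all2 (rel_close d) v (truth P s))%:R).
Proof.
move=> d0 r0; have M1 m : 1 <= (1 + r^-1) ^+ m.
  by rewrite exprn_ege1 // lerDl invr_ge0 ltW.
elim: s a P => [|B s IH] a P P0 hs.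
  rewrite [Ex _ _]/= andbT /rel_close expr0.
  case: (lerP `|a / P - 1| d) => h; last exact: chebyshev_pot.
  rewrite gerBl // divr_ge0 ?sqr_ge0 //.
  by rewrite (_ : _ + _ = (a / P - 1) ^+ 2) ?sqr_ge0 //; ring.
have [p0 hp] := hs B (or_introl erefl).
rewrite [chain _ _]/= Ex_bind.
(* Stopping at the first violation: from there on the claimed lower bound is nonpositive. *)
case: (lerP `|a / P - 1| d) => h; last first.
  apply: (@le_trans _ _ 0); first exact: chebyshev_pot.
  by apply: Ex_ge0 => z; apply: Ex_ge0 => v; rewrite ler0n.
set p := blk_prob B in p0 hp *; set N := blk_size B in hp *.
set M := (1 + r^-1) ^+ size s.
have N0 : 0 < N%:R :> R by rewrite -(pmulr_lgt0 _ p0) (lt_le_trans r0).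
pose x := a / P.
pose y := (N%:R * p)^-1.
have y0 : 0 < y by rewrite invr_gt0; exact: mulr_gt0 N0 p0.
have yr : y <= r^-1 by rewrite lef_pV2 ?posrE //; exact: mulr_gt0 N0 p0.
(* The next ratio is [x * y * z]. The inductive bound at this ratio is written as a quadratic
   polynomial in [z], so that two moments of the tally suffice. *)
apply: (@le_trans _ _ (Ex (tally (blk_betaP B) (blk_key B) N 0) (fun z =>
   (1 - 1 / d ^+ 2) + (- (x ^+ 2 * M * y ^+ 2 / d ^+ 2) * z%:R ^+ 2
     + 2 * x * y / d ^+ 2 * z%:R)))); last first.
  apply: ler_Ex => z; rewrite Ex_bind /= /rel_close h /=.
  apply: le_trans (IH _ (P * p) _ _) => [|/=|B' hB']; last 2 first.
  - by rewrite mulf_neq0 // gt_eqF.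
  - by apply: hs; right.
  rewrite -/M /x /y le_eqVlt; apply/orP; left; apply/eqP.
  by field; rewrite P0 !gt_eqF.
rewrite !ExD !Ex_cst !ExZ Ex_tally Ex_tally_sqr add0r -/(blk_prob B) -/p.
have hy : N%:R * p = y^-1 by rewrite invrK.
(* Second moment of the normalized frequency [y * z]; it is at most [1 + r^-1] because
   [y <= r^-1]. *)
have e : y ^+ 2 * ((N%:R * p) ^+ 2 + N%:R * p * (1 - p)) = 1 + y * (1 - p).
  by rewrite hy; field; rewrite gt_eqF.
have e2 : y * (N%:R * p) = 1 by rewrite hy mulfV // gt_eqF.
rewrite [leRHS](_ : _ = 1 - (x ^+ 2 * (M * (1 + y * (1 - p))) - 2 * x + 1) / d ^+ 2).
  rewrite lerD2l lerN2 ler_pM2r ?invr_gt0 ?exprn_gt0 // !lerD2r.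
  rewrite [size _]/= (exprSr _ (size s)) -/M ler_wpM2l ?sqr_ge0 //
          ler_wpM2l ?(le_trans ler01 (M1 _)) //.
  rewrite lerD2l (le_trans _ yr) // ler_piMr ?(ltW y0) ?gerBl ?(ltW p0) //.
transitivity (1 - (x ^+ 2 * (M * (y ^+ 2 * ((N%:R * p) ^+ 2 + N%:R * p * (1 - p))))
    - 2 * x * (y * (N%:R * p)) + 1) / d ^+ 2); last by rewrite e e2 mulr1.
by field; rewrite gt_eqF.
Qed.

(* Chernoff bound: each term contributes a factor of mean at most [1/2], and
   the product is at least 1 unless the good terms have the majority. *)
Lemma repeat_majority A (t : sampler A) (g : pred A) m :
  15 / 16 <= Ex t (fun a => (g a)%:R) ->
  1 - 2^-1 ^+ m <= Ex (srepeat m t) (fun s => (size s < 2 * count g s)%N%:R).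
Proof.
(* [h] is 1/4 on good values and 4 on bad ones, so its mean is at most 4 - (15/4) (15/16) =
   31/64. *)
move=> hg; pose h a : R := 4 + (- (15 / 4)) * (g a)%:R.
have hE : Ex t h <= 2^-1.
  by rewrite /h ExD ExZ Ex_cst; lra.
have h0 a : 0 < h a by rewrite /h; case: (g a) => /=; lra.
have hp s : \prod_(a <- s) h a * 4 ^+ count g s = 4 ^+ (count (predC g) s).
  elim: s => [|a s IH] /=; first by rewrite big_nil mulr1.
  rewrite big_cons !exprD -IH /h; case: (g a) => /=; rewrite !(expr0, expr1); by field.
apply: (@le_trans _ _ (1 + -1 * Ex t h ^+ m)).
  rewrite mulN1r lerD2l lerN2 lerXn2r // nnegrE ?invr_ge0 //.
  by apply: Ex_ge0 => a; apply: ltW.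
rewrite -Ex_repeat_prod -ExZ -{1}(Ex_cst (srepeat m t) 1) -ExD.
apply: ler_Ex => s; rewrite mulN1r.
have hs0 : 0 < \prod_(a <- s) h a by apply: prodr_gt0.
case: ltnP => hs; first by rewrite gerBl ltW.
rewrite subr_le0 -(@ler_pM2r _ (4 ^+ count g s)) ?exprn_gt0 // hp mul1r.
rewrite ler_eXn2l ?ltr1n //.
by move: hs; rewrite -(count_predC g s) mul2n -addnn leq_add2l.
Qed.

(** * Running a sampler only with a given probability *)

Section LazyRun.
Context (A : Type) (p : R) (hp : 0 <= p <= 1) (a0 : A) (t : sampler A) (q : nat).
Hypothesis tq : ncalls t q.

(** Skipping the run with probability [1 - p] scales the expected cost by [p]; the default [a0] is
    then returned without any query. *)
Definition lazy_run : procedure n bmin bmax A :=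
  Coin hp (fun b => if b then run t else Return n bmin bmax a0).

Lemma prob_lazy_run (E : set A) :
  ((p * Ex t \1_E + (1 - p) * \1_E a0)%:E <= prob_output c E lazy_run)%E.
Proof.
(* One step for the coin, [q] for the queries, one for the final [Return]. *)
by rewrite -(prob_upto_run E tq); apply: ereal_sup_ubound; exists q.+2.
Qed.

Lemma prob_lazy_run_setT : prob_output c setT lazy_run = 1%E.
Proof.
apply/eqP; rewrite eq_le; apply/andP; split.
  by apply: ge_ereal_sup => _ [k _ <-]; rewrite lee_fin prob_upto_le1.
apply: le_trans (prob_lazy_run setT).
rewrite lee_fin indicT (Ex_cst t 1) /cst !mulr1 subrKC //.
Qed.

Lemma cost_lazy_run : (cost c lazy_run <= (p * q%:R)%:E)%E.
Proof.
have /andP[p0 p1] := hp.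
apply: ge_ereal_sup => _ [[|k] _ <-]; rewrite lee_fin /=.
  by rewrite mulr_ge0.
have -> : calls_upto c k (Return n bmin bmax a0) = 0 by case: k.
by rewrite mulr0 addr0 ler_wpM2l // calls_upto_run.
Qed.

End LazyRun.

End Samplers.

(** * Elementary estimates *)

Section Numeric.
Context {R : realType}.

(** Apply [ln y <= y - 1] to [x] and to [x^-1]; the bound on [d] gives [x^-1 - 1 <= 2 * d]. *)
Lemma ln_near1 (d x : R) : d <= 2^-1 -> `|x - 1| <= d -> 0 < x /\ `|ln x| <= 2 * d.
Proof.
move=> d2; rewrite ler_norml => /andP[h1 h2].
have x0 : 0 < x by lra.
split=> //.
have u : ln x <= x - 1 by rewrite -{1}(subrKC 1 x) le_ln1Dx //; lra.
have l : ln x^-1 <= x^-1 - 1.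
  rewrite -{1}(subrKC 1 x^-1) le_ln1Dx // ltrBrDr addrC subrr invr_gt0 //.
rewrite lnV ?posrE // in l.
have : x^-1 - 1 <= 2 * d.
  rewrite lerBlDr -[leLHS]div1r ler_pdivrMr //.
  have := normr_ge0 (x - 1); nra.
by rewrite ler_norml => h3; apply/andP; split; lra.
Qed.

(** A converse of Bernoulli's inequality: the smallness of [m * y] absorbs the quadratic term in the
    induction. *)
Lemma compound_le (y : R) m : 0 <= y -> m%:R * y <= 2^-1 ->
  (1 + y) ^+ m <= 1 + 2 * (m%:R * y).
Proof.
move=> y0; elim: m => [|m IH] h; first by rewrite expr0 mul0r mulr0 addr0.
have my : 0 <= m%:R * y by rewrite mulr_ge0.
rewrite -natr1 mulrDl mul1r in h *.
have {}IH : (1 + y) ^+ m <= 1 + 2 * (m%:R * y) by apply: IH; lra.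
rewrite exprSr.
have : (1 + y) ^+ m * (1 + y) <= (1 + 2 * (m%:R * y)) * (1 + y).
  by rewrite ler_wpM2r //; lra.
nra.
Qed.

End Numeric.

(** * Selecting an output by majority *)

Section Majority.
Context (T : Type) (close : T -> T -> bool).

(** The truth being unknown to the procedure, the choice rests on mutual closeness of the outputs
    alone. *)
Definition pick_majority (x0 : T) (s : seq T) : T :=
  nth x0 s (find (fun v => (size s < 2 * count (close v) s)%N) s).

(** Every good element is close to the good majority, so the search succeeds; the elements close to
    its result and the good ones are two strict majorities, which must meet. *)
Lemma pick_majority_close (g : pred T) x0 s :
  (forall v w, g v -> g w -> close v w) -> (size s < 2 * count g s)%N ->
  exists w, g w && close (pick_majority x0 s) w.
Proof.
move=> gc hs; pose f v := (size s < 2 * count (close v) s)%N.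
have fg v : g v -> f v.
  move=> gv; rewrite /f (leq_trans hs) // leq_mul2l /=.
  by apply: sub_count => w; apply: gc.
have hf : has f s.
  have : has g s by rewrite has_count; case: count hs.
  by apply: sub_has.
have := nth_find x0 hf; rewrite -/(pick_majority x0 s) /f.
set v := pick_majority x0 s => hv.
have [/(has_nthP x0) [i _ hi]|] := boolP (has (predI g (close v)) s).
  by exists (nth x0 s i).
rewrite has_count.
have := count_predUI g (close v) s.
have := count_size (predU g (close v)) s.
by lia.
Qed.

End Majority.

(** * One run of the estimator and its number of calls *)

Section Estimator.
Context {R : realType} {n : nat} {bmin bmax : R} (I : covering_schedule n bmin bmax).
Local Notation t := (cs_t I).

Definition seg (j : nat) : segment n bmin bmax := I (inord j).

(* The endpoint shared by the segments [j] and [j+1], [j < t]. *)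
Definition key (j : nat) : 'I_n.+1 :=
  if seg_hi (seg j) is r%:E then inord `|r|%N else ord0.

Lemma seg_hi_lo j : (j < t)%N -> seg_hi (seg j) = seg_lo (seg j.+1).
Proof. by move=> jt; apply: cs_hi_lo; rewrite !inordK // ltnW. Qed.

(** A shared endpoint is finite: as an upper end it cannot be [-oo], as a lower end it cannot be
    [+oo]. *)
Lemma seg_hi_key j : (j < t)%N -> seg_hi (seg j) = (Posz (key j))%:E.
Proof.
move=> jt; rewrite /key.
have [h|[k ->]] := seg_hiP (seg j); last by rewrite /= inord_val.
have [|[k]] := seg_loP (seg j.+1); rewrite -seg_hi_lo // h //.
Qed.

(** The shared endpoints are strictly increasing naturals; since they do not exceed [n], this bounds
    [t]. *)
Lemma leq_key j : (j < t)%N -> (j <= key j)%N.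
Proof.
elim: j => [|j IH] // jt; apply: leq_ltn_trans (IH (ltnW jt)) _.
have := cs_lo_lt_hi (c := I) (inord j.+1).
rewrite -/(seg j.+1) -seg_hi_lo ?(ltnW jt) // !seg_hi_key ?(ltnW jt) //.
Qed.

Lemma cs_t_le : (t <= n.+1)%N.
Proof.
case E : t => [|m] //; rewrite ltnS.
by apply: leq_trans (leq_key (j := m) _) _; rewrite ?E // -ltnS.
Qed.

(** The size exceeds [r / w], so a key of probability at least [w] has expected count at least
    [r]. *)
Definition seg_block (r : R) (k : 'I_n.+1) (s : segment n bmin bmax) :=
  Block (seg_betaP s) k (Num.truncn (r / seg_w s)).+1.

Definition num_blocks (r : R) :=
  [seq seg_block r (key j) (seg j) | j <- iota 0 t].
Definition den_blocks (r : R) :=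
  [seq seg_block r (key j) (seg j.+1) | j <- iota 0 t].

(** Logarithm of the deterministic factor of [Q] at the [i]-th point; it is computable from the
    schedule. *)
Definition shift (i : nat) : R :=
  \sum_(0 <= j < i) (seg_beta (seg j.+1) - seg_beta (seg j)) * (key j)%:R.

Definition one_run (r : R) : sampler (bmin := bmin) (bmax := bmax) (n := n) ('I_t.+1 -> R) :=
  sbind (chain 1 (num_blocks r)) (fun u =>
  sbind (chain 1 (den_blocks r)) (fun v =>
  Done (fun i : 'I_t.+1 => expR (shift i) * (u`_i / v`_i)))).

Definition one_run_calls (r : R) : nat :=
  \sum_(B <- num_blocks r) blk_size B + \sum_(B <- den_blocks r) blk_size B.

Lemma ncalls_one_run r : ncalls (one_run r) (one_run_calls r).
Proof.
apply: ncalls_bind => [|u]; first exact: ncalls_chain.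
by rewrite -[X in ncalls _ X]addn0; apply: ncalls_bind => //; apply: ncalls_chain.
Qed.

(** A block has at most [2 * r / w] samples, and each segment serves at most one numerator (all but
    the last) and one denominator (all but the first). *)
Lemma one_run_calls_le r : 1 <= r -> (one_run_calls r)%:R <= 4 * r * InvWeight I.
Proof.
move=> r1; pose G j := (seg_w (seg j))^-1.
have G0 j : 0 < G j by rewrite invr_gt0; case/andP: (seg_wP (seg j)).
have hW : InvWeight I = \sum_(0 <= j < t.+1) G j.
  by rewrite big_mkord; apply: eq_bigr => i _; rewrite /G /seg inord_val.
have hN j k : (blk_size (seg_block r k (seg j)))%:R <= 2 * r * G j.
  rewrite /= -natr1 -/(G j).
  have /andP[w0 w1] := seg_wP (seg j).
  have G1 : 1 <= G j by rewrite invf_ge1.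
  have rG : 1 <= r * G j by rewrite (le_trans r1) // ler_peMr // (le_trans ler01).
  have := truncn_le (r * G j); rewrite (le_trans ler01 rG) => h.
  lra.
rewrite /one_run_calls natrD !big_map.
have -> : 4 * r * InvWeight I = 2 * r * InvWeight I + 2 * r * InvWeight I by ring.
have r2 : 0 <= 2 * r by lra.
rewrite lerD // hW.
  rewrite big_nat_recr //= mulrDr (@le_trans _ _ (2 * r * \sum_(0 <= j < t) G j)) //.
    rewrite natr_sum /index_iota subn0 big_distrr /=.
    by apply: ler_sum => j _; exact: hN (key j).
  by rewrite lerDl mulr_ge0 // ltW.
rewrite big_nat_recl // mulrDr (@le_trans _ _ (2 * r * \sum_(0 <= j < t) G j.+1)) //.
  rewrite natr_sum /index_iota subn0 big_distrr /=.
  by apply: ler_sum => j _; exact: hN (key j).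
by rewrite lerDr mulr_ge0 // ltW.
Qed.

(** * Accuracy of one run on a proper schedule *)

Context (c : 'I_n.+1 -> R).
Hypothesis c_ge0 : forall x, 0 <= c x.
Hypothesis c_neq0 : exists x, c x != 0.

(** The unknown count [c k] cancels between the two probabilities, and the exponential factor
    removes the remaining dependence on [k]. *)
Lemma gibbs_div (b b' : R) k : 0 < c k ->
  expR ((b' - b) * k%:R) * (gibbs c b k / gibbs c b' k) = Zpart c b' / Zpart c b.
Proof.
move=> ck; rewrite mulrBl expRB /gibbs.
field; rewrite !gt_eqF ?expR_gt0 ?Zpart_gt0 //.
Qed.

Hypothesis I_proper : proper_schedule c I.

Lemma num_prob j : (j < t)%N -> seg_w (seg j) <= gibbs c (seg_beta (seg j)) (key j).
Proof. by move=> jt; apply: I_proper; right; exact: seg_hi_key. Qed.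

Lemma den_prob j :
  (j < t)%N -> seg_w (seg j.+1) <= gibbs c (seg_beta (seg j.+1)) (key j).
Proof.
by move=> jt; apply: I_proper; left; rewrite -/(seg j.+1) -seg_hi_lo // seg_hi_key.
Qed.

Lemma seg_w_gt0 j : 0 < seg_w (seg j).
Proof. by case/andP: (seg_wP (seg j)). Qed.

Lemma count_key_gt0 j : (j < t)%N -> 0 < c (key j).
Proof.
move=> /num_prob h; rewrite lt0r c_ge0 andbT; apply/eqP => ck.
by move: (lt_le_trans (seg_w_gt0 j) h); rewrite /gibbs ck !mul0r ltxx.
Qed.

Lemma seg_block_large r k j : 0 < r -> seg_w (seg j) <= gibbs c (seg_beta (seg j)) k ->
  let B := seg_block r k (seg j) in
  0 < blk_prob c B /\ r <= (blk_size B)%:R * blk_prob c B.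
Proof.
move=> r0 h /=; have w0 := seg_w_gt0 j.
have p0 := lt_le_trans w0 h; split=> //.
rewrite /blk_prob /= -(@divfK _ (seg_w (seg j)) _ r) ?gt_eqF //.
apply: ler_pM => //; [by rewrite divr_ge0 ?ltW|exact: ltW|].
by rewrite divfK ?gt_eqF // ltW // truncnS_gt.
Qed.

(** The identity [gibbs_div] telescopes along the schedule, starting from the value 1 at [bmin]. *)
Lemma shift_truth r i : (i <= t)%N ->
  expR (shift i) * ((truth c 1 (num_blocks r))`_i / (truth c 1 (den_blocks r))`_i)
    = Qratio c bmin (seg_beta (seg i)).
Proof.
move=> it; rewrite !nth_truth ?size_map ?size_iota // !mul1r -!map_take !take_iota.
rewrite (minn_idPl it) !big_map /blk_prob /=.
have -> : iota 0 i = index_iota 0 i by rewrite /index_iota subn0.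
rewrite /shift; elim: i it => [|i IH] it.
  rewrite !big_nil expR0 divr1 mulr1 /Qratio.
  have -> : seg 0 = I ord0 by rewrite /seg; congr (I _); apply/val_inj; rewrite /= inordK.
  by rewrite cs_beta_first divff // gt_eqF // Zpart_gt0.
have regroup (s d x y z w : R) :
  s * d * (x * y * (z * w)) = s * (x * z) * (d * (y * w)) by ring.
rewrite !big_nat_recr //= expRD invfM regroup.
rewrite IH 1?ltnW // gibbs_div ?count_key_gt0 //.
by rewrite /Qratio; field; rewrite !gt_eqF ?Zpart_gt0.
Qed.

(** Boolean form of [accurate], so that good outputs can be counted. *)
Definition near_truth (d : R) : pred ('I_t.+1 -> R) := fun v =>
  [forall i : 'I_t.+1, (0 < v i)
     && (`|ln (v i) - ln (Qratio c bmin (seg_beta (I i)))| <= d)].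

(** From [t <= 2 * n] one gets [t / r <= d ^+ 2 / 64], so each of the two chains fails with
    probability at most 1/32. Otherwise each contributes at most [2 * d] to the logarithmic
    error. *)
Lemma Ex_one_run (d r : R) : 0 < d <= 2^-1 -> 128 * n%:R / d ^+ 2 <= r -> (0 < n)%N ->
  15 / 16 <= Ex c (one_run r) (fun v => (near_truth (4 * d) v)%:R).
Proof.
move=> /andP[d0 d2] hr n0.
have n0' : 1 <= n%:R :> R by rewrite ler1n.
have hd : 128 * n%:R <= r * d ^+ 2 by rewrite -ler_pdivrMr ?exprn_gt0.
have r0 : 0 < r by apply: lt_le_trans hr; rewrite divr_gt0 ?exprn_gt0 //; lra.
have tn : t%:R <= 2 * n%:R :> R.
  by rewrite -natrM ler_nat; have := cs_t_le; lia.
have hpot m : m = t ->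
  ((1 / 1) ^+ 2 * (1 + r^-1) ^+ m - 2 * (1 / 1) + 1) / d ^+ 2 <= 32^-1 :> R.
  move=> ->; have ht : t%:R * r^-1 <= d ^+ 2 / 64.
    rewrite ler_pdivrMr // mulrAC ler_pdivlMr //; lra.
  have dd : d ^+ 2 <= 2^-1 by rewrite expr2; nra.
  rewrite ler_pdivrMr ?exprn_gt0 // divr1 expr1n mul1r mulr1.
  have := @compound_le R r^-1 t; rewrite invr_ge0 (ltW r0) => /(_ isT) h.
  have {}h := h (le_trans ht _).
  by have := h; lra.
have hnum : forall B, List.In B (num_blocks r) ->
    0 < blk_prob c B /\ r <= (blk_size B)%:R * blk_prob c B.
  by apply: In_map_iota => j jt; apply: seg_block_large => //; exact: num_prob.
have hden : forall B, List.In B (den_blocks r) ->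
    0 < blk_prob c B /\ r <= (blk_size B)%:R * blk_prob c B.
  by apply: In_map_iota => j jt; apply: seg_block_large => //; exact: den_prob.
have := chain_close c_ge0 c_neq0 1 d0 r0 (oner_neq0 R) hnum.
have := chain_close c_ge0 c_neq0 1 d0 r0 (oner_neq0 R) hden.
have := hpot (size (num_blocks r)); have := hpot (size (den_blocks r)).
rewrite !size_map size_iota => /(_ erefl) h1 _ /(le_trans (lerB (lexx 1) h1)) hB.
move=> /(le_trans (lerB (lexx 1) h1)) hA.
set EA := Ex _ _ _ in hA; set EB := Ex _ _ _ in hB.
(* Union bound over the failures of the two chains. *)
apply: (@le_trans _ _ (EA + (EB - 1))); first by lra.
rewrite /one_run Ex_bind /EA -[EB - 1](Ex_cst c_ge0 c_neq0 (chain 1 (num_blocks r))).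
rewrite -ExD; apply: ler_Ex => // u; rewrite Ex_bind.
case hu: (all2 _ u _); last first.
  rewrite add0r (@le_trans _ _ 0) //; last first.
    by apply: Ex_ge0 => // v; rewrite ler0n.
  rewrite subr_le0 -(Ex_cst c_ge0 c_neq0 (chain 1 (den_blocks r)) 1).
  by apply: ler_Ex => // v; rewrite lern1 leq_b1.
rewrite addrC subrK; apply: ler_Ex => // v /=.
case hv: (all2 _ v _) => //; rewrite ler_nat lt0b.
apply/forallP => i.
have it : (i <= t)%N by rewrite -ltnS.
have szA : (i < size (truth c 1 (num_blocks r)))%N.
  by rewrite size_truth size_map size_iota.
have szB : (i < size (truth c 1 (den_blocks r)))%N.
  by rewrite size_truth size_map size_iota.
have [] := ln_near1 d2 (all2_nth hu szA); have [] := ln_near1 d2 (all2_nth hv szB).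
set x := u`_i / _; set y := v`_i / _ => y0 ly x0 lx.
(* Division by zero gives zero, so positivity of [x] and [y] forces the sampled denominator and both
   true products to be nonzero. *)
have v0 : v`_i != 0 by apply: contraTN y0 => /eqP v0; rewrite /y v0 mul0r ltxx.
have tA : (truth c 1 (num_blocks r))`_i != 0.
  by apply: contraTN x0 => /eqP h; rewrite /x h invr0 mulr0 ltxx.
have tB : (truth c 1 (den_blocks r))`_i != 0.
  by apply: contraTN y0 => /eqP h; rewrite /y h invr0 mulr0 ltxx.
have Q0 : 0 < Qratio c bmin (seg_beta (I i)) by rewrite divr_gt0 ?Zpart_gt0.
have -> : expR (shift i) * (u`_i / v`_i) = Qratio c bmin (seg_beta (I i)) * (x / y).
  have := shift_truth r it; rewrite /seg inord_val => <-.
  by rewrite /x /y; field; rewrite tA tB v0.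
clearbody x y; move: (Qratio _ _ _) Q0 => Q Q0.
rewrite !mulr_gt0 ?invr_gt0 //=.
rewrite lnM ?posrE ?divr_gt0 // ln_div ?posrE // addrC addKr.
move: lx ly; rewrite !ler_norml => /andP[? ?] /andP[? ?].
by apply/andP; split; lra.
Qed.

End Estimator.

(** * Number of repetitions and probability of running *)

Section Rounds.
Context {R : realType}.
Implicit Type g : R.

Definition rounds g : nat := (Num.truncn (2 * ln (2 / g))).+1.

(** Truncation at 0 makes this a legal coin bias for every real [g], as the procedure is defined for
    all parameters. *)
Definition run_prob g : R := Num.max 0 (1 - g ^+ 2).

Lemma run_probP g : 0 <= run_prob g <= 1.
Proof. by rewrite /run_prob le_max lexx ge_max ler01 /= gerBl sqr_ge0. Qed.

Lemma run_probE g : 0 < g < 1 -> run_prob g = 1 - g ^+ 2.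
Proof. by move=> /andP[g0 g1]; apply/max_idPr; rewrite subr_ge0 expr_le1 // ltW. Qed.

(** Combine [1/2 <= exp (-1/2)] with [rounds g > 2 * ln (2 / g)]. *)
Lemma half_rounds g : 0 < g -> 2^-1 ^+ rounds g <= g / 2.
Proof.
move=> g0; have h : (2^-1 : R) <= expR (- 2^-1).
  by rewrite (le_trans _ (expR_ge1Dx _)) //; lra.
have -> : g / 2 = expR (- ln (2 / g)).
  by rewrite expRN lnK ?posrE ?divr_gt0 // invf_div.
apply: (@le_trans _ _ (expR (- 2^-1) ^+ rounds g)).
  by rewrite lerXn2r ?nnegrE ?expR_ge0 ?invr_ge0.
rewrite -expRM_natl ler_expR.
have : 2 * ln (2 / g) < (rounds g)%:R by apply: truncnS_gt.
lra.
Qed.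

Lemma run_prob_success g : 0 < g < 1 -> 1 - g <= run_prob g * (1 - g / 2).
Proof.
move=> hg; rewrite run_probE //; case/andP: hg => g0 _.
(* This is exactly the difference of the two sides. *)
have : 0 <= g / 2 * (1 - g) ^+ 2 by rewrite mulr_ge0 ?sqr_ge0 // divr_ge0 // ltW.
lra.
Qed.

(* The coin of bias [1 - g^2] keeps this bound valid as [g] tends to 1, where
   [ln (1 / g)] tends to 0. *)
Lemma run_prob_rounds g : 0 < g < 1 -> run_prob g * (rounds g)%:R <= 8 * ln (1 / g).
Proof.
move=> hg; rewrite run_probE //; have /andP[g0 g1] := hg.
have hL : 1 - g <= ln (1 / g).
  rewrite div1r lnV ?posrE //.
  have : ln g <= g - 1 by rewrite -{1}(subrKC 1 g) le_ln1Dx //; lra.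
  lra.
have hl : ln (2 / g) <= 1 + ln (1 / g).
  rewrite ln_div ?posrE // ln_div ?posrE // ln1.
  have : ln (1 + 1 : R) <= 1 by apply: le_ln1Dx; lra.
  lra.
have hr : (rounds g)%:R <= 3 + 2 * ln (1 / g).
  have l0 : 0 <= 2 * ln (2 / g).
    by rewrite mulr_ge0 // ln_ge0 // ler_pdivlMr //; lra.
  have := truncn_le (2 * ln (2 / g)); rewrite l0 /rounds -natr1 => h.
  lra.
have p0 : 0 <= 1 - g ^+ 2 by nra.
apply: (le_trans (ler_wpM2l p0 hr)).
(* By [hL], the constant 3 in [hr] costs at most [6 * ln (1 / g)]; the other term costs at most
   [2 * ln (1 / g)]. *)
have : (1 - g ^+ 2) * 3 <= 6 * (1 - g) by nra.
nra.
Qed.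

End Rounds.

(** * The full procedure: accuracy and cost *)

Section Algorithm.
Context {R : realType} {n : nat} {bmin bmax : R} (I : covering_schedule n bmin bmax).
Implicit Types eps g : R.
Local Notation T := ('I_(cs_t I).+1 -> R).

Definition close (d : R) (v w : T) : bool :=
  [forall i, (0 < v i) && (`|ln (v i) - ln (w i)| <= d)].

(** [Ex_one_run] with [d = eps / 12] gives single runs of precision [4 * d = eps / 3]. *)
Definition samples_scale eps : R := 128 * n%:R / (eps / 12) ^+ 2.

Definition estimator eps g : sampler (n := n) (bmin := bmin) (bmax := bmax) T :=
  sbind (srepeat (rounds g) (one_run I (samples_scale eps))) (fun s =>
  Done (pick_majority (close (2 / 3 * eps)) (fun=> 0) s)).

Definition algorithm eps g : procedure n bmin bmax T :=
  lazy_run (run_probP g) (fun=> 0) (estimator eps g).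

Lemma ncalls_estimator eps g :
  ncalls (estimator eps g) (rounds g * one_run_calls I (samples_scale eps)).
Proof.
rewrite -[X in ncalls _ X]addn0; apply: ncalls_bind => //.
by apply: ncalls_repeat; apply: ncalls_one_run.
Qed.

Context (c : 'I_n.+1 -> R).
Hypothesis c_ge0 : forall x, 0 <= c x.
Hypothesis c_neq0 : exists x, c x != 0.

(** Good outputs are within [2 / 3 * eps] of each other, and the chosen one is that close to some
    good output, itself within [eps / 3] of the truth. *)
Lemma pick_majority_accurate eps (s : seq T) :
  (size s < 2 * count (near_truth c (eps / 3)) s)%N ->
  accurate c I eps (pick_majority (close (2 / 3 * eps)) (fun=> 0) s).
Proof.
move=> /(pick_majority_close (close := close (2 / 3 * eps)) (fun=> 0)) [].
  move=> v w /forallP hv /forallP hw; apply/forallP => i.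
  have /andP[-> /=] := hv i; have /andP[_] := hw i.
  by rewrite !ler_norml => /andP[? ?] /andP[? ?]; apply/andP; split; lra.
move=> w /andP[/forallP hw /forallP hv] i.
have /andP[v0 dv] := hv i; have /andP[_ dw] := hw i; split=> //.
move: dv dw; rewrite !ler_norml => /andP[? ?] /andP[? ?]; apply/andP; split; lra.
Qed.

Lemma prob_algorithm_accurate eps g :
  (0 < n)%N -> 0 < eps < 1 -> 0 < g < 1 -> proper_schedule c I ->
  ((1 - g)%:E <= prob_output c (accurate c I eps) (algorithm eps g))%E.
Proof.
move=> n0 /andP[e0 e1] hg I_proper; have /andP[g0 g1] := hg.
have hrun : 15 / 16 <=
    Ex c (one_run I (samples_scale eps)) (fun v => (near_truth c (eps / 3) v)%:R).
  have -> : eps / 3 = 4 * (eps / 12) by field.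
  by apply: Ex_one_run => //; apply/andP; split; lra.
have hmaj := repeat_majority c_ge0 c_neq0 (rounds g) hrun.
apply: (le_trans _ (prob_lazy_run c _ _ (ncalls_estimator eps g) _)).
rewrite lee_fin; have /andP[p0 p1] := run_probP g.
apply: (le_trans (run_prob_success hg)).
(* The contribution of the default output is nonnegative and is dropped. *)
rewrite ler_wpDr ?mulr_ge0 ?subr_ge0 ?indicE ?ler0n // ler_wpM2l //.
apply: (@le_trans _ _ (1 - 2^-1 ^+ rounds g)); first by rewrite lerD2l lerN2 half_rounds.
apply: (le_trans hmaj); rewrite [leRHS]Ex_bind; apply: ler_Ex => // s /=.
case: ltnP => // /pick_majority_accurate hs.
by rewrite indicE mem_set.
Qed.

(** The constant collects 4 from [one_run_calls_le], 8 from [run_prob_rounds] and [128 * 12 ^+ 2]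
    from [samples_scale]. *)
Lemma cost_algorithm eps g : (0 < n)%N -> 0 < eps < 1 -> 0 < g < 1 ->
  (cost c (algorithm eps g) <=
    (32 * 128 * 12 ^+ 2 * (n%:R * InvWeight I / eps ^+ 2 * ln (1 / g)))%:E)%E.
Proof.
move=> n0 /andP[e0 e1] hg.
apply: le_trans (cost_lazy_run c_ge0 c_neq0 _ _ (ncalls_estimator eps g)) _.
have n1 : 1 <= n%:R :> R by rewrite ler1n.
have r1 : 1 <= samples_scale eps.
  have d0 : 0 < eps / 12 by lra.
  have d1 : eps / 12 <= 1 by lra.
  rewrite /samples_scale ler_pdivlMr ?exprn_gt0 // mul1r.
  by have := exprn_ile1 2 (ltW d0) d1; lra.
rewrite lee_fin natrM mulrA.
apply: le_trans (ler_wpM2l _ (one_run_calls_le I r1)) _.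
  by rewrite mulr_ge0 //; case/andP: (run_probP g).
apply: le_trans (ler_wpM2r _ (run_prob_rounds hg)) _.
  rewrite mulr_ge0 ?sumr_ge0 //; first lra.
  by move=> i _; rewrite invr_ge0; case/andP: (seg_wP (I i)) => /ltW.
by rewrite le_eqVlt; apply/orP; left; apply/eqP; rewrite /samples_scale; field; rewrite gt_eqF.
Qed.

End Algorithm.

Theorem theorem39 (R : realType) :
  exists2 C : R, 0 < C &
  exists P : forall (n : nat) (bmin bmax : R)
                    (I : covering_schedule n bmin bmax) (eps gamma : R),
               procedure n bmin bmax ('I_(cs_t I).+1 -> R),
  forall (n : nat) (bmin bmax : R) (I : covering_schedule n bmin bmax)
         (eps gamma : R) (c : 'I_n.+1 -> R),
    (2 <= n)%N -> bmin < bmax ->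
    0 < eps < 1 -> 0 < gamma < 1 ->
    (forall x, 0 <= c x) -> (exists x, c x != 0) ->
    [/\ prob_output c setT (P n bmin bmax I eps gamma) = 1%E,
        (cost c (P n bmin bmax I eps gamma) <=
           (C * (n%:R * InvWeight I / eps ^+ 2 * ln (1 / gamma)))%:E)%E
      & proper_schedule c I ->
        ((1 - gamma)%:E <=
           prob_output c (accurate c I eps) (P n bmin bmax I eps gamma))%E].
Proof.
exists (32 * 128 * 12 ^+ 2); first by rewrite !mulr_gt0.
exists (fun n bmin bmax I eps g => algorithm I eps g).
move=> n bmin bmax I eps g c n2 _ he hg c_ge0 c_neq0.
have n0 : (0 < n)%N by apply: leq_trans n2.
split; last exact: prob_algorithm_accurate.
- exact/prob_lazy_run_setT/ncalls_estimator.
- exact: cost_algorithm.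
Qed.
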